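(* Let $A,B\in\mathcal M_n$ be accretive with $W(A),W(B)\subset S_\alpha$ for some $0\le\alpha<\pi/2$. Then for every unitarily invariant norm $\|\cdot\|$ on $\mathcal M_n$ and every $f\in\mathfrak m$, $$\|A\sigma_fB\|\le\sec^3(\alpha)\,\big(\|A\|\,\sigma_f\,\|B\|\big),$$ where for positive scalars $a,b$, $a\sigma_fb=a\,f(b/a)$.
   Context: A matrix $A$ is accretive if $\Re A=\frac{A+A^*}{2}$ is positive definite. $W(A)$ is the numerical range, $S_\alpha=\{z:\Re z>0,\ |\Im z|\le\tan(\alpha)\Re z\}$. A norm is unitarily invariant if $\|UXV\|=\|X\|$ for all unitary $U,V$. $\mathfrak m$ is the set of matrix monotone $f:(0,\infty)\to(0,\infty)$ with $f(1)=1$; each has a unique probability measure $\nu_f$ on $[0,1]$ with $f(x)=\int_0^1((1-t)+tx^{-1})^{-1}d\nu_f(t)$, $x>0$. For accretive $A,B$: $A!_tB=((1-t)A^{-1}+tB^{-1})^{-1}$ and $A\sigma_fB:=\int_0^1A!_tB\,d\nu_f(t)$. *)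

(* Defs.v *)
From HB Require Import structures.
From mathcomp Require Import all_boot all_order all_algebra.
From mathcomp Require Import all_classical all_reals all_analysis.
From mathcomp Require Import complex.
Set Implicit Arguments.
Unset Strict Implicit.
Unset Printing Implicit Defensive.
Import Order.TTheory GRing.Theory Num.Theory.
Local Open Scope ring_scope.
Local Open Scope classical_set_scope.

Section Defs.
Variable R : realType.
Local Notation C := (R[i]).

Definition toC (x : R) : C := Complex x 0.

Definition adj m n (A : 'M[C]_(m, n)) : 'M[C]_(n, m) := (map_mx Num.conj A)^T.

Definition quad n (A : 'M[C]_n) (x : 'cV[C]_n) : C := (adj x *m A *m x) 0 0.

(* positive definite (x^* A x > 0 for x <> 0; in C, 0 < z means z real positive) *)
Definition posdef n (A : 'M[C]_n) : Prop := forall x : 'cV[C]_n, x != 0 -> 0 < quad A x.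

Definition possemidef n (A : 'M[C]_n) : Prop := forall x : 'cV[C]_n, 0 <= quad A x.

Definition loewner_le n (X Y : 'M[C]_n) : Prop := possemidef (Y - X).

Definition re_mx n (A : 'M[C]_n) : 'M[C]_n := (2%:R)^-1 *: (A + adj A).

Definition accretive n (A : 'M[C]_n) : Prop := posdef (re_mx A).

Definition numerical_range n (A : 'M[C]_n) : set C :=
  [set z | exists x : 'cV[C]_n, (adj x *m x) 0 0 = 1 /\ z = quad A x].

Definition sector (alpha : R) : set C :=
  [set z | 0 < complex.Re z /\ `|complex.Im z| <= tan alpha * complex.Re z].

Definition unitary n (U : 'M[C]_n) : Prop := U *m adj U = 1%:M.

Definition unitarily_invariant_norm n (N : 'M[C]_n -> R) : Prop :=
  [/\ forall X, 0 <= N X,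
      forall X, N X = 0 -> X = 0,
      forall (c : C) X, N (c *: X) = Normc.normc c * N X,
      forall X Y, N (X + Y) <= N X + N Y
    & forall U V X, unitary U -> unitary V -> N (U *m X *m V) = N X].

Definition fun_mx_rel (f : R -> R) k (X FX : 'M[C]_k) : Prop :=
  exists (U : 'M[C]_k) (d : 'rV[R]_k),
    [/\ unitary U, forall i, 0 < d 0 i,
        X = U *m diag_mx (map_mx toC d) *m adj U
      & FX = U *m diag_mx (map_mx (fun r => toC (f r)) d) *m adj U].

Definition matrix_monotone (f : R -> R) : Prop :=
  forall k (X Y FX FY : 'M[C]_k),
    fun_mx_rel f X FX -> fun_mx_rel f Y FY -> loewner_le X Y -> loewner_le FX FY.

Definition in_frak_m (f : R -> R) : Prop :=
  [/\ forall x, 0 < x -> 0 < f x, f 1 = 1 & matrix_monotone f].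

Definition represents (f : R -> R) (nu : probability R R) : Prop :=
  nu `[0, 1] = 1%E /\
  forall x, 0 < x -> f x = Rintegral nu `[0, 1] (fun t => ((1 - t) + t / x)^-1).

Definition harm_mean n (t : R) (A B : 'M[C]_n) : 'M[C]_n :=
  invmx (toC (1 - t) *: invmx A + toC t *: invmx B).

Definition mx_integral n (nu : probability R R) (F : R -> 'M[C]_n) : 'M[C]_n :=
  \matrix_(i, j) Complex (Rintegral nu `[0, 1] (fun t => complex.Re (F t i j)))
                         (Rintegral nu `[0, 1] (fun t => complex.Im (F t i j))).

Definition mx_mean n (nu : probability R R) (A B : 'M[C]_n) : 'M[C]_n :=
  mx_integral nu (fun t => harm_mean t A B).

Definition scalar_mean (f : R -> R) (a b : R) : R := a * f (b / a).

End Defs.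

(* Main.v *)
(** Write [<x, A y>] for [x^* A y]. Rotating the numerical range gives, for a matrix with numerical
    range in the sector, [2 cos(alpha) Re <x, A u> <= Re <x, A x> + Re <u, A u>]. For [H = A !_t B],
    every [x] splits as [(1-t) u + t v] with [H x = A u = B v], and this inequality yields
    [Re <x, H x> <= sec^2(alpha) ((1-t) p^2 Re <x, A x> + t r^2 Re <x, B x>)] as soon as
    [(1-t) p + t r = 1]. The choice [p = h / ||A||], [r = h / ||B||], where [h] is the weighted harmonic
    mean of the two norms, makes [(1-t) p^2 ||A|| + t r^2 ||B|| = h]. Integrating in [t], the mean [M]
    satisfies [2 Re <x, M y> <= Re <x, Y x> + Re <y, Y y>] for a combination [Y] of [A] and [B] with
    [||Y|| <= sec^3(alpha) (||A|| sigma_f ||B||)]. Testing this on singular vectors of [M] bounds its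
    singular values by diagonal entries of an average of two unitary conjugates of [Y], and
    [||M|| <= ||Y||] follows since a unitarily invariant norm decreases under pinching and under
    multiplication by diagonal contractions. *)
Require Import Defs.
From HB Require Import structures.
From mathcomp Require Import all_boot all_order all_algebra.
From mathcomp Require Import all_classical all_reals all_analysis.
From mathcomp Require Import complex.
From mathcomp Require Import measurable_realfun ring lra.
Import Order.TTheory GRing.Theory Num.Theory.
Local Open Scope ring_scope.
Local Open Scope classical_set_scope.

Set Implicit Arguments.
Unset Strict Implicit.
Unset Printing Implicit Defensive.

(** * Sesquilinear forms and the sector *)

Section ComplexParts.
Variable R : realType.
Implicit Types z w : R[i].
Local Notation Re := complex.Re.
Local Notation Im := complex.Im.

Lemma complexReD z w : Re (z + w) = Re z + Re w. Proof. by case: z w => ? ? []. Qed.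
Lemma complexImD z w : Im (z + w) = Im z + Im w. Proof. by case: z w => ? ? []. Qed.
Lemma complexReN z : Re (- z) = - Re z. Proof. by case: z. Qed.
Lemma complexImN z : Im (- z) = - Im z. Proof. by case: z. Qed.
Lemma complexReM z w : Re (z * w) = Re z * Re w - Im z * Im w.
Proof. by case: z w => ? ? []. Qed.
Lemma complexImM z w : Im (z * w) = Re z * Im w + Im z * Re w.
Proof. by case: z w => ? ? []. Qed.
Lemma complexReV z : Re z^-1 = Re z / (Re z ^+ 2 + Im z ^+ 2). Proof. by case: z. Qed.
Lemma complexImV z : Im z^-1 = - (Im z / (Re z ^+ 2 + Im z ^+ 2)). Proof. by case: z. Qed.
Lemma complexReJ z : Re (Num.conj z) = Re z. Proof. by case: z. Qed.
Lemma complexImJ z : Im (Num.conj z) = - Im z. Proof. by case: z. Qed.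

Definition partsE := (complexReD, complexImD, complexReN, complexImN, complexReM, complexImM,
  complexReV, complexImV, complexReJ, complexImJ).

Lemma complex_ext z w : Re z = Re w -> Im z = Im w -> z = w.
Proof. by case: z w => ? ? [] ? ? /= -> ->. Qed.

Lemma toCE (x : R) : toC x = real_complex R x. Proof. by []. Qed.
Lemma conj_toC (x : R) : Num.conj (toC x) = toC x.
Proof. by apply: complex_ext; rewrite !partsE//= oppr0. Qed.
Lemma normc_toC (x : R) : Normc.normc (toC x) = `|x|.
Proof. by rewrite /= expr0n addr0 sqrtr_sqr. Qed.

End ComplexParts.

(* Locked, since unification of distinct instances would unfold the matrix products. *)
HB.lock Definition sform (R : realType) n (A : 'M[R[i]]_n) (x y : 'cV[R[i]]_n) : R[i] :=
  (adj x *m A *m y) 0 0.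

Section Adjoint.
Variable R : realType.
Local Notation C := R[i].
Local Notation Re := complex.Re.
Local Notation Im := complex.Im.

Lemma adjmxM m n p (A : 'M[C]_(m, n)) (B : 'M[C]_(n, p)) :
  adj (A *m B) = adj B *m adj A.
Proof. by rewrite /adj map_mxM trmx_mul. Qed.

Lemma adjmxK m n (A : 'M[C]_(m, n)) : adj (adj A) = A.
Proof. by apply/matrixP=> i j; rewrite !mxE conjCK. Qed.

Lemma adjmxD m n (A B : 'M[C]_(m, n)) : adj (A + B) = adj A + adj B.
Proof. by apply/matrixP=> i j; rewrite !mxE rmorphD. Qed.

Lemma adjmxZ m n c (A : 'M[C]_(m, n)) : adj (c *: A) = Num.conj c *: adj A.
Proof. by apply/matrixP=> i j; rewrite !mxE rmorphM. Qed.

Lemma adjmx1 n : adj (1%:M : 'M[C]_n) = 1%:M.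
Proof. by rewrite /adj map_mx1 trmx1. Qed.

Lemma adjmx_diag n (d : 'rV[C]_n) : adj (diag_mx d) = diag_mx (map_mx Num.conj d).
Proof. by rewrite /adj map_diag_mx tr_diag_mx. Qed.


Lemma quad_sform n (A : 'M[C]_n) x : quad A x = sform A x x. Proof. by rewrite sform.unlock. Qed.

Lemma sformDl n (A : 'M[C]_n) x y z : sform A (x + y) z = sform A x z + sform A y z.
Proof. by rewrite sform.unlock adjmxD !mulmxDl mxE. Qed.

Lemma sformDr n (A : 'M[C]_n) x y z : sform A z (x + y) = sform A z x + sform A z y.
Proof. by rewrite sform.unlock mulmxDr mxE. Qed.

Lemma sformZl n (A : 'M[C]_n) c x y : sform A (c *: x) y = Num.conj c * sform A x y.
Proof. by rewrite sform.unlock adjmxZ -!scalemxAl mxE. Qed.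

Lemma sformZr n (A : 'M[C]_n) c x y : sform A x (c *: y) = c * sform A x y.
Proof. by rewrite sform.unlock -scalemxAr mxE. Qed.

Lemma sformDm n (A B : 'M[C]_n) x y : sform (A + B) x y = sform A x y + sform B x y.
Proof. by rewrite sform.unlock mulmxDr mulmxDl mxE. Qed.

Lemma sformZm n c (A : 'M[C]_n) x y : sform (c *: A) x y = c * sform A x y.
Proof. by rewrite sform.unlock -scalemxAr -scalemxAl mxE. Qed.

Lemma sform_adj n (A : 'M[C]_n) x y : sform (adj A) x y = Num.conj (sform A y x).
Proof.
rewrite sform.unlock -[adj x]mulmx1 -[y in LHS]adjmxK -mulmxA.
have -> : adj x *m 1%:M *m (adj A *m adj (adj y)) = adj (adj y *m A *m x).
  by rewrite !adjmxM adjmxK mulmx1.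
by rewrite !mxE.
Qed.

Lemma sform_sum n (A : 'M[C]_n) x y :
  sform A x y = \sum_j \sum_i (Num.conj (x i 0) * y j 0) * A i j.
Proof.
rewrite sform.unlock mxE; apply: eq_bigr => j _; rewrite mxE big_distrl /=.
by apply: eq_bigr => i _; rewrite !mxE mulrAC.
Qed.

Lemma sform_col n (A U V : 'M[C]_n) i j :
  sform A (col i U) (col j V) = (adj U *m A *m V) i j.
Proof.
rewrite sform.unlock; have -> : adj (col i U) = row i (adj U).
  by apply/matrixP=> a b; rewrite !mxE.
rewrite -row_mul [LHS]mxE [RHS]mxE; apply: eq_bigr => k _.
by rewrite [col _ _ _ _]mxE [row _ _ _ _]mxE.
Qed.

Lemma accretive_gt0 n (A : 'M[C]_n) x : accretive A -> x != 0 -> 0 < Re (sform A x x).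
Proof.
move=> accA x0; have := accA x x0; rewrite quad_sform /re_mx sformZm sformDm sform_adj.
have -> : 2%:R^-1 = toC (2^-1) :> C by rewrite toCE fmorphV rmorph_nat.
by rewrite ltcE => /andP[_]; rewrite !partsE/=; lra.
Qed.

End Adjoint.

Section SectorialForms.
Variable R : realType.
Local Notation C := R[i].
Local Notation Re := complex.Re.
Local Notation Im := complex.Im.
Variables (n : nat) (alpha : R).
Hypothesis alpha_ge0 : 0 <= alpha.
Hypothesis alpha_lt : alpha < pi / 2.

Lemma cos_sector_gt0 : 0 < cos alpha.
Proof. by apply: cos_gt0_pihalf; apply/andP; move: alpha_ge0 alpha_lt (pi_gt0 R) => *; split; lra. Qed.

Lemma sin_sector_gt0 : alpha != 0 -> 0 < sin alpha.
Proof.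
move=> a0; apply: sin_gt0_pi; apply/andP; move: alpha_ge0 alpha_lt (pi_gt0 R) => *.
split; last lra.
by rewrite lt0r a0 alpha_ge0.
Qed.

(** The condition [|Im| <= tan(alpha) Re] is multiplied through by [cos(alpha)]. It is homogeneous
    in [x], so it needs no unit vectors and also makes sense at [x = 0]. *)
Definition sectorial (A : 'M[C]_n) := forall x : 'cV[C]_n,
  cos alpha * `|Im (sform A x x)| <= sin alpha * Re (sform A x x).

Lemma sform1_gt0 (x : 'cV[C]_n) : x != 0 -> exists2 r : R, 0 < r & (adj x *m x) 0 0 = toC r.
Proof.
move=> x0.
have E : (adj x *m x) 0 0 = toC (\sum_i (Re (x i 0) ^+ 2 + Im (x i 0) ^+ 2)).
  rewrite toCE rmorph_sum mxE; apply: eq_bigr => i _; rewrite !mxE.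
  by apply: complex_ext; rewrite !partsE/=; ring.
have [i xi0] : exists i, x i 0 != 0.
  apply/existsP; apply: contraNT x0; rewrite negb_exists => /forallP h.
  by apply/eqP/matrixP=> i j; rewrite ord1 mxE; apply/eqP; rewrite -[_ == _]negbK h.
eexists; last exact: E.
rewrite (bigD1 i)//= ltr_pwDl//; last first.
  by apply: sumr_ge0 => j _; rewrite addr_ge0 ?sqr_ge0.
rewrite lt0r addr_ge0 ?sqr_ge0// paddr_eq0 ?sqr_ge0// !sqrf_eq0 andbT.
by apply: contraNN xi0 => /andP[/eqP ? /eqP ?]; apply/eqP/complex_ext.
Qed.

(** Both sides are homogeneous of degree two in [x]. Dividing a nonzero [x] by its Euclidean length
    [s] puts the value of the form in the numerical range. *)
Lemma numerical_range_sectorial (A : 'M[C]_n) :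
  numerical_range A `<=` sector alpha -> sectorial A.
Proof.
move=> WA x; have [->|x0] := eqVneq x 0.
  by rewrite sform.unlock mulmx0 mxE/= normr0 !mulr0.
have [r r0 xx] := sform1_gt0 x0.
set s := Num.sqrt r; have s0 : 0 < s by rewrite sqrtr_gt0.
have s2 : s ^+ 2 = r by rewrite sqr_sqrtr// ltW.
have := WA (quad A (toC s^-1 *: x)) => -[|].
  exists (toC s^-1 *: x); split => //.
  rewrite adjmxZ conj_toC -scalemxAl -scalemxAr !mxE -/((adj x *m x) 0 0).
  move: xx; rewrite [in LHS]mxE => ->; apply: complex_ext; rewrite !partsE/=; last by ring.
  by rewrite -s2; field; rewrite gt_eqF.
move=> _; rewrite quad_sform sformZl sformZr conj_toC !partsE/= !mul0r !subr0 !addr0.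
rewrite !normrM (gtr0_norm (x := s^-1)) ?invr_gt0// /tan.
set I := `|_|; set Q := Re _ => h.
have c0 := cos_sector_gt0.
have : s ^+ 2 * cos alpha * (s^-1 * (s^-1 * I)) <=
       s ^+ 2 * cos alpha * (sin alpha / cos alpha * (s^-1 * (s^-1 * Q))).
  by rewrite ler_pM2l// mulr_gt0// exprn_gt0.
have -> : s ^+ 2 * cos alpha * (s^-1 * (s^-1 * I)) = cos alpha * I.
  by field; rewrite gt_eqF.
suff -> : s ^+ 2 * cos alpha * (sin alpha / cos alpha * (s^-1 * (s^-1 * Q))) = sin alpha * Q.
  by [].
by field; rewrite !gt_eqF.
Qed.

(* With z = x - e^{-i alpha} u and z' = x - e^{i alpha} u, the inequalities
   Re (i e^{-i alpha} z^* A z) >= 0 and Re (-i e^{i alpha} z'^* A z') >= 0 add up to the claim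
   multiplied by 2 sin(alpha): the terms in u^* A x cancel. For alpha = 0 they only say that A is
   Hermitian, and positivity at x - u is used instead. *)
Lemma sectorial_CS (A : 'M[C]_n) x u : sectorial A ->
  (forall z, 0 <= Re (sform A z z)) ->
  2 * cos alpha * Re (sform A x u) <= Re (sform A x x) + Re (sform A u u).
Proof.
move=> sA pA; have ca := cos_sector_gt0.
have cs : cos alpha ^+ 2 + sin alpha ^+ 2 = 1 by rewrite cos2Dsin2.
set c := cos alpha in ca cs *; set s := sin alpha in cs.
have key (a b : R) : let z := x + Complex a b *: u in
  Re (sform A z z) = Re (sform A x x) + (a ^+ 2 + b ^+ 2) * Re (sform A u u)
    + (a * (Re (sform A x u) + Re (sform A u x))
    + b * (Im (sform A u x) - Im (sform A x u))) /\
  Im (sform A z z) = Im (sform A x x) + (a ^+ 2 + b ^+ 2) * Im (sform A u u)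
    + (a * (Im (sform A x u) + Im (sform A u x))
    + b * (Re (sform A x u) - Re (sform A u x))).
  rewrite /= !sformDl !sformDr !sformZl !sformZr !partsE.
  by rewrite -[Re (Complex a b)]/a -[Im (Complex a b)]/b; split; ring.
have [k1 k2] := key (- c) s; have [l1 l2] := key (- c) (- s).
have [a0|/sin_sector_gt0 s0] := eqVneq alpha 0.
  have s0 : s = 0 by rewrite /s a0 sin0.
  have c1 : c = 1 by rewrite /c a0 cos0.
  have I0 z : Im (sform A z z) = 0.
    have := sA z; rewrite -/c -/s s0 c1 mul1r mul0r normr_le0 => /eqP->//.
  (* Since the form is real at [x + i u], the real parts of [x^* A u] and [u^* A x] coincide. *)
  have [m1 _] := key (-1) 0; have [_ n2] := key 0 1.
  have := pA (x + Complex (-1) 0 *: u); rewrite m1 c1.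
  have := I0 (x + Complex 0 1 *: u); rewrite n2 !I0.
  clear; move: (Re _) (Re _) (Re _) (Re _) (Im _) (Im _) => p1 xx uu r1 ? ?.
  lra.
rewrite -/s in s0.
have := sA (x + Complex (- c) (- s) *: u); have := sA (x + Complex (- c) s *: u).
rewrite -/c -/s => /(le_trans (ler_wpM2l (ltW ca) (ler_norm _))) S1.
rewrite -normrN => /(le_trans (ler_wpM2l (ltW ca) (ler_norm _))) S2.
move: S1 S2; rewrite k1 k2 l1 l2.
have -> : (- c) ^+ 2 + s ^+ 2 = 1 by rewrite sqrrN.
have -> : (- c) ^+ 2 + (- s) ^+ 2 = 1 by rewrite !sqrrN.
move=> S1 S2; rewrite -(ler_pM2l s0); move: S1 S2; clear.
move: (Re _) (Re _) (Re _) (Re _) (Im _) (Im _) (Im _) (Im _) => p1 xx uu r1.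
move=> ? ? ? ?; lra.
Qed.

End SectorialForms.

(** * Weighted harmonic means *)

Section HarmonicMean.
Variable R : realType.
Local Notation C := R[i].
Local Notation Re := complex.Re.
Local Notation Im := complex.Im.
Variable n : nat.
Implicit Types (A B H : 'M[C]_n) (x y u v : 'cV[C]_n) (t : R).

Lemma sform_mulr A x u : sform A x u = sform 1%:M x (A *m u).
Proof. by rewrite sform.unlock mulmx1 mulmxA. Qed.

Lemma sformC x y : sform 1%:M x y = Num.conj (sform 1%:M y x).
Proof. by rewrite -sform_adj adjmx1. Qed.

(** A singular [A] has a nonzero row vector [v] with [v A = 0], and the form then vanishes at the
    adjoint of [v]. *)
Lemma posRe_unitmx A : (forall x, x != 0 -> 0 < Re (sform A x x)) -> A \in unitmx.
Proof.
move=> pA; rewrite unitmxE unitfE; apply/negP => /det0P[v v0 vA].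
have /pA : adj v != 0.
  by apply: contraNneq v0 => v0; rewrite -[v]adjmxK v0; apply/eqP/matrixP=> i j; rewrite !mxE conjC0.
by rewrite sform.unlock adjmxK vA mul0mx mxE ltxx.
Qed.

Lemma accretive_unitmx A : accretive A -> A \in unitmx.
Proof. by move=> accA; apply: posRe_unitmx => x; apply: accretive_gt0. Qed.

Lemma accretive_ge0 A x : accretive A -> 0 <= Re (sform A x x).
Proof.
move=> accA; have [->|x0] := eqVneq x 0; last exact/ltW/accretive_gt0.
by rewrite sform.unlock mulmx0 mxE.
Qed.

Lemma sform_invmx A y : A \in unitmx ->
  sform (invmx A) y y = Num.conj (sform A (invmx A *m y) (invmx A *m y)).
Proof. by move=> Au; rewrite sform_mulr sformC [in RHS]sform_mulr mulKVmx. Qed.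

(** The form of [A^-1] at [y] is the conjugate of the form of [A] at [A^-1 y], so inverses of
    accretive matrices again have forms with positive real part. *)
Lemma harm_mean_denom_unitmx A B t : accretive A -> accretive B -> 0 <= t <= 1 ->
  toC (1 - t) *: invmx A + toC t *: invmx B \in unitmx.
Proof.
move=> accA accB /andP[t0 t1]; apply: posRe_unitmx => y y0.
have uA := accretive_unitmx accA; have uB := accretive_unitmx accB.
rewrite sformDm !sformZm !sform_invmx// !partsE/= !mul0r !subr0.
have inv0 X : X \in unitmx -> invmx X *m y != 0.
  by move=> uX; apply: contraNneq y0 => Xy; rewrite -[y](mulKVmx uX) Xy mulmx0.
have := accretive_gt0 accA (inv0 _ uA); have := accretive_gt0 accB (inv0 _ uB).
move: (Re _) (Re _) => b a b0 a0.
(* One of the weights [1 - t] and [t] may vanish. Comparing [t] with [1/2] selects one that is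
   certainly positive. *)
have [t12|t12] := ltP t (2^-1); first by rewrite ltr_pwDl ?mulr_gt0 ?mulr_ge0 ?(ltW b0)// subr_gt0; lra.
by rewrite ltr_wpDl ?mulr_gt0 ?mulr_ge0 ?subr_ge0 ?(ltW a0)//; lra.
Qed.

(** With [H] the harmonic mean, take [u = A^-1 H x] and [v = B^-1 H x]. Their weighted sum is
    [H^-1 H x = x]. *)
Lemma harm_mean_split A B t x : accretive A -> accretive B -> 0 <= t <= 1 ->
  exists u v, [/\ x = toC (1 - t) *: u + toC t *: v,
    harm_mean t A B *m x = A *m u & harm_mean t A B *m x = B *m v].
Proof.
move=> accA accB t01; have uK := harm_mean_denom_unitmx accA accB t01.
exists (invmx A *m (harm_mean t A B *m x)), (invmx B *m (harm_mean t A B *m x)).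
split; rewrite ?mulKVmx ?accretive_unitmx//.
by rewrite !scalemxAl -mulmxDl /harm_mean mulKVmx.
Qed.

Lemma sform_harm_mean A B t x u v : 
  x = toC (1 - t) *: u + toC t *: v ->
  harm_mean t A B *m x = A *m u -> harm_mean t A B *m x = B *m v ->
  sform (harm_mean t A B) x x = toC (1 - t) * sform A u u + toC t * sform B v v.
Proof.
move=> xE HA HB; rewrite sform_mulr {1}xE sformDl !sformZl !conj_toC {1}HA HB.
by rewrite -!sform_mulr.
Qed.

Lemma harm_mean_gt0 A B t x : accretive A -> accretive B -> 0 <= t <= 1 -> x != 0 ->
  0 < Re (sform (harm_mean t A B) x x).
Proof.
move=> accA accB t01 x0; have uK := harm_mean_denom_unitmx accA accB t01.
have [u [v [xE HA HB]]] := harm_mean_split x accA accB t01.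
have Hx0 : harm_mean t A B *m x != 0.
  by apply: contraNneq x0 => Hx; rewrite -[x](mulKVmx uK) Hx mulmx0.
have u0 : u != 0 by apply: contraNneq Hx0 => u0; rewrite HA u0 mulmx0.
have v0 : v != 0 by apply: contraNneq Hx0 => v0; rewrite HB v0 mulmx0.
rewrite (sform_harm_mean xE HA HB) !partsE/= !mul0r !subr0.
have := accretive_gt0 accA u0; have := accretive_gt0 accB v0.
move: (Re _) (Re _) => b a b0 a0; move/andP: t01 => [t0 t1].
have [t12|t12] := ltP t (2^-1); first by rewrite ltr_pwDl ?mulr_gt0 ?mulr_ge0 ?(ltW b0)// subr_gt0; lra.
by rewrite ltr_wpDl ?mulr_gt0 ?mulr_ge0 ?subr_ge0 ?(ltW a0)//; lra.
Qed.

Lemma harm_mean_ge0 A B t x : accretive A -> accretive B -> 0 <= t <= 1 ->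
  0 <= Re (sform (harm_mean t A B) x x).
Proof.
move=> accA accB t01; have [->|x0] := eqVneq x 0; last exact/ltW/harm_mean_gt0.
by rewrite sform.unlock mulmx0 mxE.
Qed.

Variable alpha : R.
Hypothesis alpha_ge0 : 0 <= alpha.
Hypothesis alpha_lt : alpha < pi / 2.

(** By [sform_harm_mean], the form at [x] is a convex combination of a value of the form of [A] and
    one of [B], and the sector is convex. *)
Lemma harm_mean_sectorial A B t : accretive A -> accretive B ->
  sectorial alpha A -> sectorial alpha B ->
  0 <= t <= 1 -> sectorial alpha (harm_mean t A B).
Proof.
move=> accA accB sA sB t01 x.
have [u [v [xE HA HB]]] := harm_mean_split x accA accB t01.
rewrite (sform_harm_mean xE HA HB) !partsE/= !mul0r !subr0 !addr0.
have /andP[t0 t1] := t01; have c0 := ltW (cos_sector_gt0 alpha_ge0 alpha_lt).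
apply: le_trans (ler_wpM2l c0 (ler_normD _ _)) _.
rewrite !normrM (ger0_norm t0) (@ger0_norm _ (1 - t)) ?subr_ge0//.
rewrite !mulrDr [leLHS]addrC ![cos alpha * (_ * _)]mulrCA ![sin alpha * (_ * _)]mulrCA addrC.
by rewrite lerD// ler_wpM2l ?subr_ge0.
Qed.

(* With H the harmonic mean and x = (1-t) u + t v, the form of H at x is x^* A u = x^* B v;
   the weights p and r are free parameters, to be optimized for the norms of A and B. *)
Lemma harm_mean_le A B t p r x : accretive A -> accretive B ->
  sectorial alpha A -> sectorial alpha B ->
  0 <= t <= 1 -> (1 - t) * p + t * r = 1 ->
  Re (sform (harm_mean t A B) x x) <= (cos alpha)^-1 ^+ 2 *
    ((1 - t) * p ^+ 2 * Re (sform A x x) + t * r ^+ 2 * Re (sform B x x)).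
Proof.
move=> accA accB sA sB t01 pr1.
have [u [v [xE HA HB]]] := harm_mean_split x accA accB t01.
have c0 := cos_sector_gt0 alpha_ge0 alpha_lt.
(* This is [sectorial_CS] at the vectors [(k / cos(alpha)) x] and [w]. The scaling absorbs the
   cosine on the left and produces the squared secant on the right. *)
have CS X w k : accretive X -> sectorial alpha X ->
    2 * k * Re (sform X x w) <=
    (cos alpha)^-1 ^+ 2 * k ^+ 2 * Re (sform X x x) + Re (sform X w w).
  move=> accX sX.
  have := sectorial_CS alpha_ge0 alpha_lt (toC ((cos alpha)^-1 * k) *: x) w sX
    (fun z => accretive_ge0 z accX).
  rewrite !sformZl sformZr conj_toC !partsE/= !mul0r !subr0.
  have -> : 2 * cos alpha * ((cos alpha)^-1 * k * Re (sform X x w)) = 2 * k * Re (sform X x w).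
    by field; rewrite gt_eqF.
  by rewrite mulrA -expr2 exprMn.
have := CS A u p accA sA; have := CS B v r accB sB.
rewrite (sform_mulr A x u) (sform_mulr B x v) -HA -HB -sform_mulr.
have qE := congr1 (@complex.Re R) (sform_harm_mean xE HA HB).
move: qE; rewrite !partsE/= !mul0r !subr0; move/andP: t01 => [t0 t1].
move: (Re (sform (harm_mean t A B) x x)) => q.
move: (Re (sform A x x)) (Re (sform B x x)) (Re _) (Re _) => a b uu vv.
move: (_ ^-1 ^+ 2) => s qE h1 h2.
(* The two inequalities are averaged with weights [1 - t] and [t]. The left sides add up to [2 q],
   and by [qE] the terms in [u] and [v] add up to [q], which leaves one [q] to be bounded. *)
have {}h1 := ler_wpM2l t0 h1.
have t1' : 0 <= 1 - t by rewrite subr_ge0.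
have {}h2 := ler_wpM2l t1' h2.
have := lerD h2 h1.
have -> : (1 - t) * (2 * p * q) + t * (2 * r * q) = 2 * ((1 - t) * p + t * r) * q by ring.
rewrite pr1 mulr1 => h.
by move: h; rewrite {h1 h2 pr1}; lra.
Qed.

End HarmonicMean.

(** * Unitarily invariant norms *)

Section Unitary.
Variable R : realType.
Local Notation C := R[i].
Local Notation Re := complex.Re.
Local Notation Im := complex.Im.
Variable n : nat.
Implicit Types (U V : 'M[C]_n) (d : 'rV[C]_n).

Lemma unitary1 : unitary (1%:M : 'M[C]_n).
Proof. by rewrite /unitary adjmx1 mulmx1. Qed.

Lemma unitary_adjl U : unitary U -> adj U *m U = 1%:M.
Proof. exact: mulmx1C. Qed.

Lemma unitary_adj U : unitary U -> unitary (adj U).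
Proof. by move=> uU; rewrite /unitary adjmxK unitary_adjl. Qed.

Lemma unitarymx_unitary U : U \is unitarymx -> unitary U.
Proof. by move/unitarymxP; rewrite /unitary /adj -map_trmx. Qed.

Lemma normc1_mulJ (z : C) : Normc.normc z = 1 -> z * Num.conj z = 1.
Proof.
case: z => a b /= h; apply: complex_ext; rewrite !partsE/=; last by ring.
have : (Num.sqrt (a ^+ 2 + b ^+ 2)) ^+ 2 = 1 by rewrite h expr1n.
by rewrite sqr_sqrtr ?addr_ge0 ?sqr_ge0// => <-; ring.
Qed.

Lemma unitary_diag d : (forall j, Normc.normc (d 0 j) = 1) -> unitary (diag_mx d).
Proof.
move=> d1; rewrite /unitary adjmx_diag mulmx_diag; apply/matrixP => i j.
by rewrite !mxE normc1_mulJ.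
Qed.

(** Diagonalize [M M^*] by a unitary [P] and put [Y = P M], so that [Y Y^*] is diagonal.
    Invertibility of [M] makes its entries positive. With [D] the diagonal matrix of their square
    roots, [W = D^-1 Y] is unitary and [M = P^* D W]. *)
Lemma svd (M : 'M[C]_n) : M \in unitmx ->
  exists (V W : 'M[C]_n) (s : 'rV[R]_n),
    [/\ unitary V, unitary W, forall j, 0 <= s 0 j &
        M = V *m diag_mx (map_mx (@toC R) s) *m W].
Proof.
move=> uM; pose G := M *m adj M.
have hG : G \is hermsymmx.
  apply/is_hermitianmxP; rewrite expr0 scale1r -map_trmx.
  by rewrite -[RHS]/(adj G) adjmxM adjmxK.
have := orthomx_spectralP (hermitian_normalmx hG).
set P := spectralmx G; set sp := spectral_diag G => GE.
have uP : unitary P by apply/unitarymx_unitary/spectral_unitarymx.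
have PP : P \in unitmx by apply: spectral_unit.
pose Y := P *m M.
have YY : Y *m adj Y = diag_mx sp.
  rewrite /Y adjmxM mulmxA -(mulmxA P) -/G GE !mulmxA mulmxV// mul1mx -mulmxA uP.
  by rewrite mulmx1.
have uY : Y \in unitmx by rewrite unitmx_mul PP.
pose s := \row_j Num.sqrt (Re (sp 0 j)).
(* The eigenvalue is the squared length of row [j] of [Y], hence nonnegative. It is nonzero because
   [Y Y^*] is invertible. *)
have spE j : 0 < Re (sp 0 j) /\ Im (sp 0 j) = 0.
  have spj : sp 0 j = \sum_k Y j k * Num.conj (Y j k).
    have := congr1 (fun X : 'M[C]_n => X j j) YY; rewrite !mxE eqxx mulr1n => <-.
    by apply: eq_bigr => k _; rewrite !mxE.
  have sp_ge0 : 0 <= sp 0 j by rewrite spj sumr_ge0// => k _; rewrite mul_conjC_ge0.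
  have sp0 : sp 0 j != 0.
    have : diag_mx sp \in unitmx.
      by rewrite -YY unitmx_mul uY /adj unitmx_tr map_unitmx.
    by rewrite unitmxE det_diag unitfE => /prodf_neq0 ->.
  have : 0 < sp 0 j by rewrite lt0r sp0.
  by rewrite ltcE => /andP[/eqP]/=.
have s0 j : 0 < s 0 j by rewrite mxE sqrtr_gt0; case: (spE j).
pose D := diag_mx (map_mx (@toC R) s).
pose W := diag_mx (map_mx (fun r => toC r^-1) s) *m Y.
exists (adj P), W, s; split.
- exact: unitary_adj.
- rewrite /unitary /W adjmxM adjmx_diag mulmxA -(mulmxA _ Y) YY !mulmx_diag.
  apply/matrixP => i j; rewrite !mxE; congr (_ *+ _); rewrite conj_toC.
  have [sj0 sjI] := spE i.
  have := s0 i; rewrite mxE; set w := Num.sqrt _ => sj.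
  have -> : sp 0 i = toC (w ^+ 2).
    by apply: complex_ext => //=; rewrite sqr_sqrtr// ltW.
  apply: complex_ext; rewrite !partsE/=; last by ring.
  by field; rewrite gt_eqF.
- by move=> j; apply/ltW.
- rewrite -mulmxA /W (mulmxA (diag_mx _)) mulmx_diag.
  have -> : diag_mx (\row_j (map_mx (@toC R) s 0 j * map_mx (fun r => toC r^-1) s 0 j)) = 1%:M.
    apply/matrixP => i j; rewrite !mxE; congr (_ *+ _).
    have := s0 i; rewrite mxE => sj; apply: complex_ext; rewrite !partsE/=; last by ring.
    by field; rewrite gt_eqF.
  by rewrite mul1mx /Y mulmxA unitary_adjl// mul1mx.
Qed.

End Unitary.

Section UnitarilyInvariantNorm.
Variable R : realType.
Local Notation C := R[i].
Local Notation Re := complex.Re.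
Local Notation Im := complex.Im.
Variables (n : nat) (N : 'M[C]_n -> R).
Hypothesis hN : unitarily_invariant_norm N.
Implicit Types (X Y Z U V : 'M[C]_n) (d : 'rV[C]_n).

Lemma uinorm_ge0 X : 0 <= N X. Proof. by case: hN. Qed.

Lemma uinormD X Y : N (X + Y) <= N X + N Y. Proof. by case: hN. Qed.

Lemma uinormZ (r : R) X : 0 <= r -> N (toC r *: X) = r * N X.
Proof. by move=> r0; case: hN => _ _ -> _ _; rewrite normc_toC ger0_norm. Qed.

Lemma uinorm_unitary U V X : unitary U -> unitary V -> N (U *m X *m V) = N X.
Proof. by case: hN => _ _ _ _; apply. Qed.

Lemma uinorm_unitaryl U X : unitary U -> N (U *m X) = N X.
Proof. by move=> uU; rewrite -[U *m X]mulmx1 (uinorm_unitary _ uU (@unitary1 _ _)). Qed.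

Lemma normcN1 : Normc.normc (- 1 : C) = 1.
Proof. by rewrite normcN Normc.normc1. Qed.

Definition update1 (j : 'I_n) (c : C) : 'rV[C]_n := \row_k (if k == j then c else 1).

Lemma unitary_update1 j c : Normc.normc c = 1 -> unitary (diag_mx (update1 j c)).
Proof.
by move=> c1; apply: unitary_diag => k; rewrite mxE; case: ifP => _; rewrite ?Normc.normc1.
Qed.

(* c is a convex combination of w and -w, for some w of modulus 1. *)
Lemma uinorm_update1 j c X : Normc.normc c <= 1 -> N (diag_mx (update1 j c) *m X) <= N X.
Proof.
set r := Normc.normc c => r1.
have r0 : 0 <= r by rewrite /r; case: (c) => a b /=; apply: sqrtr_ge0.
have [w w1 cE] : exists2 w : C, Normc.normc w = 1 & c = toC r * w.
  have [c0|c0] := eqVneq c 0.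
    by exists 1; rewrite ?Normc.normc1// /r c0 Normc.normc0 mul0r.
  have r_neq0 : r != 0 by apply: contraNneq c0 => r0'; apply/eqP/Normc.eq0_normc.
  exists (toC r^-1 * c); first by rewrite Normc.normcM normc_toC ger0_norm ?invr_ge0// mulVf.
  by rewrite mulrA toCE -rmorphM/= mulfV// mul1r.
have -> : diag_mx (update1 j c) = toC ((1 + r) / 2) *: diag_mx (update1 j w)
    + toC ((1 - r) / 2) *: diag_mx (update1 j (- w)).
  apply/matrixP => i k; rewrite !mxE !mulrnAr -mulrnDl; congr (_ *+ _).
  by case: ifP => _; rewrite ?cE; apply: complex_ext; rewrite !partsE/=; field.
rewrite mulmxDl -!scalemxAl; apply: le_trans (uinormD _ _) _.
rewrite !uinormZ; [|lra|lra].
rewrite (uinorm_unitaryl _ (unitary_update1 j w1)).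
rewrite uinorm_unitaryl; last by apply: unitary_update1; rewrite normcN.
by move: (N X) => a; lra.
Qed.

(** A diagonal contraction is a product of contractions that each act on a single coordinate. The
    induction splits these off along a list of indices outside which the entries are 1. *)
Lemma uinorm_diag_contraction d X : (forall j, Normc.normc (d 0 j) <= 1) ->
  N (diag_mx d *m X) <= N X.
Proof.
move=> d1; suff H (s : seq 'I_n) (e : 'rV[C]_n) : (forall j, j \notin s -> e 0 j = 1) ->
    (forall j, Normc.normc (e 0 j) <= 1) -> N (diag_mx e *m X) <= N X.
  by apply: (H (index_enum 'I_n)) => // j; rewrite mem_index_enum.
elim: s e => [|j s IH] e es e1.
  have -> : e = const_mx 1 by apply/rowP => j; rewrite mxE es.
  by rewrite diag_const_mx mul1mx.
pose e' : 'rV[C]_n := \row_k (if k == j then 1 else e 0 k).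
have -> : diag_mx e = diag_mx (update1 j (e 0 j)) *m diag_mx e'.
  rewrite mulmx_diag; congr diag_mx; apply/rowP => k; rewrite !mxE.
  by case: eqP => [->|_]; rewrite ?mulr1 ?mul1r.
rewrite -mulmxA; apply: le_trans (uinorm_update1 _ _ (e1 j)) _.
apply: IH => k; rewrite mxE; case: eqP => [_|/eqP kj] //; last by rewrite Normc.normc1.
by move=> ks; rewrite es// inE negb_or kj.
Qed.

(** Averaging a matrix with its conjugate by the reflection that flips the sign of coordinate [j]
    erases the off-diagonal entries of row and column [j]. The average does not increase the norm,
    and running through all indices leaves the diagonal. *)
Lemma uinorm_pinching Z : N (diag_mx (\row_j Z j j)) <= N Z.
Proof.
(* The list [s] records the indices whose rows and columns are already cleared off the diagonal. *)
pose mask (s : seq 'I_n) : 'M[C]_n :=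
  \matrix_(i, k) (if (i == k) || ((i \notin s) && (k \notin s)) then Z i k else 0).
suff H s : N (mask s) <= N Z.
  suff -> : diag_mx (\row_j Z j j) = mask (index_enum 'I_n) by [].
  apply/matrixP => i k; rewrite !mxE !mem_index_enum orbF.
  by case: eqP => [->|_]; rewrite ?mulr1n ?mulr0n.
elim: s => [|j s IH].
  suff -> : mask [::] = Z by [].
  by apply/matrixP => i k; rewrite !mxE !in_nil orbT.
pose D := diag_mx (update1 j (- 1)).
have -> : mask (j :: s) = toC (2^-1) *: mask s + toC (2^-1) *: (D *m mask s *m D).
  apply/matrixP => i k; rewrite /D mul_diag_mx mul_mx_diag !mxE !inE.
  have half (z : C) : z = toC (2^-1) * z + toC (2^-1) * z.
    by apply: complex_ext; rewrite !partsE/=; field.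
  have [<-|ik] /= := eqVneq i k.
    by rewrite {1}[Z i i]half; case: ifP => _; rewrite ?mulN1r ?mulrN1 ?opprK ?mul1r ?mulr1.
  have [ij|ij] /= := eqVneq i j.
    have kj : k != j by rewrite -ij eq_sym.
    by rewrite (negbTE kj) mulN1r mulr1 mulrN subrr.
  have [kj|kj] /= := eqVneq k j.
    by rewrite andbF mul1r mulrN1 mulrN subrr.
  by rewrite mul1r mulr1 -half.
apply: le_trans (uinormD _ _) _.
have uD : unitary D by apply/unitary_update1/normcN1.
rewrite !uinormZ ?invr_ge0// (uinorm_unitary _ uD uD).
by move: IH; lra.
Qed.

(* The singular values of M are dominated by the diagonal entries of the average of Y
   in the two bases of singular vectors of M. *)
Lemma uinorm_le_form M Y : M \in unitmx ->
  (forall x y, 2 * Re (sform M x y) <= Re (sform Y x x) + Re (sform Y y y)) ->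
  N M <= N Y.
Proof.
move=> uM MY; have [V [W [s [uV uW s0 ME]]]] := svd uM.
pose Z := toC (2^-1) *: (adj V *m Y *m V) + toC (2^-1) *: (W *m Y *m adj W).
have NZ : N Z <= N Y.
  apply: le_trans (uinormD _ _) _; rewrite !uinormZ ?invr_ge0//.
  rewrite (uinorm_unitary _ (unitary_adj uV) uV) (uinorm_unitary _ uW (unitary_adj uW)).
  by move: (N _) => a; lra.
apply: le_trans NZ; apply: le_trans (uinorm_pinching Z).
rewrite ME (uinorm_unitary _ uV uW).
(* On the [j]-th pair of singular vectors the form of [M] equals [s 0 j], while the average of the
   forms of [Y] at these two vectors is the real part of [Z j j]. *)
have sZ j : s 0 j <= Re (Z j j).
  have := MY (col j V) (col j (adj W)).
  have -> : Re (Z j j) = 2^-1 * (Re (sform Y (col j V) (col j V)) +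
      Re (sform Y (col j (adj W)) (col j (adj W)))).
    have -> (c : C) (X1 X2 : 'M[C]_n) : (c *: X1 + c *: X2) j j = c * (X1 j j + X2 j j).
      by rewrite !mxE mulrDr.
    by rewrite !sform_col adjmxK [in LHS]complexReM complexReD/= mul0r subr0.
  suff -> : Re (sform M (col j V) (col j (adj W))) = s 0 j by lra.
  rewrite sform_col ME !mulmxA (unitary_adjl uV) mul1mx -mulmxA uW mulmx1.
  by rewrite !mxE eqxx mulr1n.
(* The entries of [d] have modulus at most 1, since [s 0 j <= Re (Z j j) <= |Z j j|]. If [Z j j = 0]
   then [s 0 j = 0] as well, and the quotient is 0 by convention. *)
clearbody Z; pose d := \row_j (toC (s 0 j) / Z j j).
have -> : diag_mx (map_mx (@toC R) s) = diag_mx d *m diag_mx (\row_j Z j j).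
  rewrite mulmx_diag; congr diag_mx; apply/rowP => j; rewrite !mxE.
  have [Zj0|Zj0] := eqVneq (Z j j) 0; last by rewrite divfK.
  have -> : s 0 j = 0 by apply/eqP; rewrite eq_le s0 andbT; have := sZ j; rewrite Zj0.
  by rewrite Zj0 mulr0.
apply: uinorm_diag_contraction => j; rewrite !mxE Normc.normcM Normc.normcV normc_toC.
have [Zj0|Zj0] := eqVneq (Normc.normc (Z j j)) 0; first by rewrite Zj0 invr0 mulr0.
have nZ0 : 0 <= Normc.normc (Z j j) by case: (Z j j) => a b /=; apply: sqrtr_ge0.
rewrite ger0_norm// ler_pdivrMr ?lt0r ?Zj0// mul1r; apply: le_trans (sZ j) _.
case: (Z j j) => a b /=; apply: le_trans (ler_norm _) _.
by rewrite -sqrtr_sqr ler_sqrt ?lerDl ?sqr_ge0// addr_ge0 ?sqr_ge0.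
Qed.

End UnitarilyInvariantNorm.

(** * Integration over the representing measure *)

Section ComplexMeasurable.
Context (d : measure_display) (T : measurableType d) (R : realType).
Variable D : set T.
Local Notation C := R[i].
Local Notation Re := complex.Re.
Local Notation Im := complex.Im.
Implicit Types (f : T -> R) (F G : T -> C).

(** On nonnegative reals the inverse, with [0^-1 = 0], is the power function of exponent [-1], which
    is measurable. *)
Lemma measurable_funV_ge0 f : measurable_fun D f -> (forall x, 0 <= f x) ->
  measurable_fun D (fun x => (f x)^-1).
Proof.
move=> mf f0; have -> : (fun x => (f x)^-1) = (@powR R ^~ (-1)) \o f.
  by apply/funext => x /=; rewrite powR_inv1.
by apply: measurableT_comp => //; exact: measurable_powR.
Qed.

Definition cmeasurable F :=
  measurable_fun D (fun x => Re (F x)) /\ measurable_fun D (fun x => Im (F x)).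

Lemma eq_cmeasurable F G : {in D, F =1 G} -> cmeasurable F -> cmeasurable G.
Proof.
move=> FG [mr mi]; split; [apply: eq_measurable_fun mr|apply: eq_measurable_fun mi];
by move=> x Dx; rewrite FG.
Qed.

Lemma cmeasurable_cst c : cmeasurable (fun=> c).
Proof. by split; exact: measurable_cst. Qed.

Lemma cmeasurable_toC f : measurable_fun D f -> cmeasurable (fun x => toC (f x)).
Proof. by split => //; exact: measurable_cst. Qed.

Lemma cmeasurableD F G : cmeasurable F -> cmeasurable G -> cmeasurable (fun x => F x + G x).
Proof.
move=> [? ?] [? ?]; split; under eq_fun do rewrite partsE; exact: measurable_funD.
Qed.

Lemma cmeasurableM F G : cmeasurable F -> cmeasurable G -> cmeasurable (fun x => F x * G x).
Proof.
move=> [? ?] [? ?]; split; under eq_fun do rewrite partsE.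
  by apply: measurable_funB; exact: measurable_funM.
by apply: measurable_funD; exact: measurable_funM.
Qed.

Lemma cmeasurableV F : cmeasurable F -> cmeasurable (fun x => (F x)^-1).
Proof.
move=> [mr mi].
have mV : measurable_fun D (fun x => (Re (F x) ^+ 2 + Im (F x) ^+ 2)^-1).
  apply: measurable_funV_ge0 => [|x]; last by rewrite addr_ge0 ?sqr_ge0.
  by apply: measurable_funD; exact: measurable_funX.
split; under eq_fun do rewrite partsE; first exact: measurable_funM.
by apply: measurable_funN; exact: measurable_funM.
Qed.

Lemma cmeasurable_sum (I : Type) (s : seq I) (F : I -> T -> C) :
  (forall i, cmeasurable (F i)) -> cmeasurable (fun x => \sum_(i <- s) F i x).
Proof.
move=> mF; elim: s => [|i s IH].
  by under eq_fun do rewrite big_nil; exact: cmeasurable_cst.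
by under eq_fun do rewrite big_cons; exact: cmeasurableD.
Qed.

Lemma cmeasurable_prod (I : Type) (s : seq I) (F : I -> T -> C) :
  (forall i, cmeasurable (F i)) -> cmeasurable (fun x => \prod_(i <- s) F i x).
Proof.
move=> mF; elim: s => [|i s IH].
  by under eq_fun do rewrite big_nil; exact: cmeasurable_cst.
by under eq_fun do rewrite big_cons; exact: cmeasurableM.
Qed.

Lemma cmeasurable_det m (M : T -> 'M[C]_m) :
  (forall i j, cmeasurable (fun x => M x i j)) -> cmeasurable (fun x => \det (M x)).
Proof.
move=> mM; apply: cmeasurable_sum => s; apply: cmeasurableM; first exact: cmeasurable_cst.
by apply: cmeasurable_prod.
Qed.

(** By Cramer's rule, each entry of the inverse is a polynomial in the entries divided by the
    determinant. *)
Lemma cmeasurable_invmx m (M : T -> 'M[C]_m) :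
  (forall x, D x -> M x \in unitmx) ->
  (forall i j, cmeasurable (fun x => M x i j)) ->
  forall i j, cmeasurable (fun x => invmx (M x) i j).
Proof.
move=> uM mM i j.
(* The formula is asserted on [D] only, because [invmx] returns a singular matrix unchanged. *)
apply: (@eq_cmeasurable (fun x => (\det (M x))^-1 * \adj (M x) i j)).
  by move=> x /set_mem/uM uMx; rewrite /invmx uMx !mxE.
apply: cmeasurableM; first by apply/cmeasurableV/cmeasurable_det.
under eq_fun do rewrite mxE.
apply: cmeasurableM; first exact: cmeasurable_cst.
by apply: cmeasurable_det => k l; under eq_fun do rewrite !mxE.
Qed.

End ComplexMeasurable.

Section ComplexIntegral.
Context (d : measure_display) (T : measurableType d) (R : realType).
Variables (mu : probability T R) (D : set T).
Hypothesis mD : measurable D.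
Local Notation C := R[i].
Local Notation Re := complex.Re.
Local Notation Im := complex.Im.
Implicit Types (f g : T -> R) (F G : T -> C).

Lemma bounded_integrable f K : measurable_fun D f -> (forall x, D x -> `|f x| <= K) ->
  mu.-integrable D (EFin \o f).
Proof.
move=> mf fK; apply: measurable_bounded_integrable => //.
  by apply: le_lt_trans (probability_le1 _ mD) _; rewrite ltry.
exists K; split; first exact: num_real.
by move=> y Ky x Dx; apply: le_trans (fK _ Dx) (ltW Ky).
Qed.

(** If the integral were zero, [f] would vanish almost everywhere on [D]. As [f] is positive there,
    [D] would lie in a null set, against [mu D = 1]. *)
Lemma Rintegral_gt0 f : mu D = 1%E -> mu.-integrable D (EFin \o f) ->
  (forall x, D x -> 0 < f x) -> 0 < Rintegral mu D f.
Proof.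
move=> D1 fi f0; rewrite lt0r Rintegral_ge0 ?andbT; last by move=> x /f0/ltW.
apply/eqP => If0.
have I0 : (\int[mu]_(x in D) `|(EFin \o f) x| = 0)%E.
  transitivity (\int[mu]_(x in D) (EFin \o f) x)%E.
    by apply: eq_integral => x /set_mem/f0 fx /=; rewrite gtr0_norm.
  by rewrite -[LHS]fineK ?integrable_fin_num//; congr (_%:E).
have mf : measurable_fun D (EFin \o f) by case/integrableP : fi.
have [E [mE E0 subE]] := (ae_eq_integral_abs mu mD mf).1 I0.
have DE : D `<=` E.
  move=> x Dx; apply: subE => /= /(_ Dx) [fx0].
  by have := f0 x Dx; rewrite fx0 ltxx.
have : (mu D <= mu E)%E by apply: le_measure => //; exact/mem_set.
by rewrite D1 E0 lee_fin ler10.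
Qed.

Definition cintegrable F := mu.-integrable D (EFin \o (fun x => Re (F x))) /\
  mu.-integrable D (EFin \o (fun x => Im (F x))).

(** On the unit interval this agrees by conversion with the entries of [mx_integral]. *)
Definition cintegral F := Complex (Rintegral mu D (fun x => Re (F x)))
  (Rintegral mu D (fun x => Im (F x))).

(** This lemma and the next three put the arithmetic inside a real-valued integrand, the shape that
    [partsE] produces for real and imaginary parts. *)
Lemma integrableEZl (c : R) f : mu.-integrable D (EFin \o f) ->
  mu.-integrable D (EFin \o (fun x => c * f x)).
Proof. by move=> fi; exact: (integrableZl mD c fi). Qed.

Lemma integrableEZr (c : R) f : mu.-integrable D (EFin \o f) ->
  mu.-integrable D (EFin \o (fun x => f x * c)).
Proof. by under [in X in _ -> X]eq_fun do rewrite mulrC; exact: integrableEZl. Qed.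

Lemma integrableED f g : mu.-integrable D (EFin \o f) -> mu.-integrable D (EFin \o g) ->
  mu.-integrable D (EFin \o (fun x => f x + g x)).
Proof. by move=> fi gi; exact: (integrableD mD fi gi). Qed.

Lemma integrableEB f g : mu.-integrable D (EFin \o f) -> mu.-integrable D (EFin \o g) ->
  mu.-integrable D (EFin \o (fun x => f x - g x)).
Proof. by move=> fi gi; exact: (integrableB mD fi gi). Qed.

Lemma cintegrableD F G : cintegrable F -> cintegrable G -> cintegrable (fun x => F x + G x).
Proof.
by move=> [? ?] [? ?]; split; under eq_fun do rewrite partsE; exact: integrableED.
Qed.

Lemma cintegralD F G : cintegrable F -> cintegrable G ->
  cintegral (fun x => F x + G x) = cintegral F + cintegral G.
Proof.
move=> [? ?] [? ?]; apply: complex_ext; rewrite !partsE/=.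
  by rewrite -RintegralD//; apply: eq_Rintegral => x _; rewrite partsE.
by rewrite -RintegralD//; apply: eq_Rintegral => x _; rewrite partsE.
Qed.

Lemma cintegrableZ c F : cintegrable F -> cintegrable (fun x => c * F x).
Proof.
move=> [? ?]; split; under eq_fun do rewrite partsE.
  by apply: integrableEB; exact: integrableEZl.
by apply: integrableED; exact: integrableEZl.
Qed.

Lemma cintegralZ c F : cintegrable F -> cintegral (fun x => c * F x) = c * cintegral F.
Proof.
move=> [? ?]; apply: complex_ext; rewrite !partsE/=.
  rewrite -!RintegralZl// -RintegralB//; [|exact: integrableEZl..].
  by apply: eq_Rintegral => x _; rewrite partsE.
rewrite -!RintegralZl// -RintegralD//; [|exact: integrableEZl..].
by apply: eq_Rintegral => x _; rewrite partsE.
Qed.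

Lemma cintegrable0 : cintegrable (fun=> 0).
Proof. by split; apply: (@bounded_integrable _ 0) => // x _; rewrite normr0. Qed.

Lemma cintegral0 : cintegral (fun=> 0) = 0.
Proof. by apply: complex_ext; rewrite /= Rintegral_cst// mul0r. Qed.

Lemma cintegrable_sum (I : Type) (s : seq I) (F : I -> T -> C) :
  (forall i, cintegrable (F i)) -> cintegrable (fun x => \sum_(i <- s) F i x).
Proof.
move=> Fi; elim: s => [|i s IH].
  by under eq_fun do rewrite big_nil; exact: cintegrable0.
by under eq_fun do rewrite big_cons; exact: cintegrableD.
Qed.

Lemma cintegral_sum (I : Type) (s : seq I) (F : I -> T -> C) :
  (forall i, cintegrable (F i)) ->
  cintegral (fun x => \sum_(i <- s) F i x) = \sum_(i <- s) cintegral (F i).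
Proof.
move=> Fi; elim: s => [|i s IH].
  by under eq_fun do rewrite big_nil; rewrite big_nil cintegral0.
under eq_fun do rewrite big_cons.
by rewrite big_cons -IH cintegralD//; exact: cintegrable_sum.
Qed.

Lemma cintegrable_sform n (H : T -> 'M[C]_n) x y :
  (forall i j, cintegrable (fun t => H t i j)) -> cintegrable (fun t => sform (H t) x y).
Proof.
move=> Hi; under eq_fun do rewrite sform_sum.
by apply: cintegrable_sum => j; apply: cintegrable_sum => i; exact: cintegrableZ.
Qed.

(** For fixed vectors the form is a finite linear combination of matrix entries, so it commutes with
    the integral. *)
Lemma sform_cintegral n (H : T -> 'M[C]_n) x y :
  (forall i j, cintegrable (fun t => H t i j)) ->
  sform (\matrix_(i, j) cintegral (fun t => H t i j)) x y = cintegral (fun t => sform (H t) x y).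
Proof.
move=> Hi; under [in RHS]eq_fun do rewrite sform_sum.
rewrite sform_sum cintegral_sum; last first.
  by move=> j; apply: cintegrable_sum => i; exact: cintegrableZ.
apply: eq_bigr => j _; rewrite cintegral_sum; last by move=> i; exact: cintegrableZ.
by apply: eq_bigr => i _; rewrite mxE cintegralZ.
Qed.

End ComplexIntegral.

(** * Weighted harmonic means of positive scalars *)

Section ScalarHarmonicMean.
Variable R : realType.
Implicit Types a b t : R.

Definition scalar_harm_mean t a b := ((1 - t) / a + t / b)^-1.

(** Both [1/a] and [1/b] are at least [1/(a + b)], hence so is their convex combination. The bound
    is uniform in [t] and keeps the mean positive and bounded. *)
Lemma scalar_harm_mean_denom_gt0 t a b : 0 < a -> 0 < b -> 0 <= t <= 1 ->
  (a + b)^-1 <= (1 - t) / a + t / b.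
Proof.
move=> a0 b0 /andP[t0 t1].
have ab : 0 < a + b by rewrite addr_gt0.
have ha : (a + b)^-1 <= a^-1 by rewrite lef_pV2 ?posrE// lerDl ltW.
have hb : (a + b)^-1 <= b^-1 by rewrite lef_pV2 ?posrE// lerDr ltW.
have := lerD (ler_wpM2l (_ : 0 <= 1 - t) ha) (ler_wpM2l t0 hb).
rewrite subr_ge0 => /(_ t1); apply: le_trans.
by rewrite -mulrDl subrK mul1r.
Qed.

Lemma scalar_harm_mean_bounds t a b : 0 < a -> 0 < b -> 0 <= t <= 1 ->
  0 < scalar_harm_mean t a b <= a + b.
Proof.
move=> a0 b0 t01; have h := scalar_harm_mean_denom_gt0 a0 b0 t01.
have ab : 0 < (a + b)^-1 by rewrite invr_gt0 addr_gt0.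
rewrite /scalar_harm_mean invr_gt0 (lt_le_trans ab h)/=.
by rewrite -[leRHS]invrK lef_pV2 ?posrE// (lt_le_trans ab h).
Qed.

(** This is the constraint that [harm_mean_le] puts on its weights, for [p = h / a] and [r = h / b]
    with [h] the scalar mean. *)
Lemma scalar_harm_mean_weights t a b : 0 < a -> 0 < b -> 0 <= t <= 1 ->
  (1 - t) * (scalar_harm_mean t a b / a) + t * (scalar_harm_mean t a b / b) = 1.
Proof.
move=> a0 b0 t01; have /andP[h _] := scalar_harm_mean_bounds a0 b0 t01.
have -> : (1 - t) * (scalar_harm_mean t a b / a) + t * (scalar_harm_mean t a b / b) =
  scalar_harm_mean t a b * ((1 - t) / a + t / b) by ring.
by rewrite mulVf//; rewrite invr_gt0 in h; rewrite gt_eqF.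
Qed.

Lemma measurable_scalar_harm_mean a b : 0 < a -> 0 < b ->
  measurable_fun (`[0, 1] : set R) (fun t => scalar_harm_mean t a b).
Proof.
(* [measurable_funV_ge0] asks for nonnegativity at every real [t]. The absolute value provides it
   and changes nothing on the unit interval. *)
move=> a0 b0; apply: (@eq_measurable_fun _ _ _ _ _ (fun t => `|(1 - t) / a + t / b|^-1)).
  move=> t /set_mem; rewrite /= in_itv/= => t01.
  rewrite ger0_norm//; apply: le_trans (scalar_harm_mean_denom_gt0 a0 b0 t01).
  by rewrite invr_ge0 addr_ge0 ?ltW.
apply: measurable_funV_ge0 => //; apply: measurableT_comp => //.
apply: measurable_funD; apply: measurable_funM => //; try exact: measurable_cst.
exact: measurable_funB.
Qed.

End ScalarHarmonicMean.

(** * The matrix mean as an integral, and its domination by a combination of [A] and [B] *)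

Section MatrixMean.
Variables (R : realType) (n : nat) (nu : probability R R) (alpha : R).
Local Notation C := R[i].
Local Notation Re := complex.Re.
Local Notation Im := complex.Im.
Variables (A B : 'M[C]_n).
Hypothesis alpha_ge0 : 0 <= alpha.
Hypothesis alpha_lt : alpha < pi / 2.
Hypothesis accA : accretive A.
Hypothesis accB : accretive B.
Hypothesis sA : sectorial alpha A.
Hypothesis sB : sectorial alpha B.
Local Notation D := (`[0, 1] : set R).

(** [sectorial_CS] for the harmonic mean reduces the mixed term to the forms at [x] and [y], at the
    cost of one secant. [harm_mean_le] bounds each of these at the cost of two more. *)
Lemma harm_mean_CS p r t x y : 0 <= t <= 1 -> (1 - t) * p + t * r = 1 ->
  2 * Re (sform (harm_mean t A B) x y) <= (cos alpha)^-1 ^+ 3 *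
   ((1 - t) * p ^+ 2 * (Re (sform A x x) + Re (sform A y y)) +
    t * r ^+ 2 * (Re (sform B x x) + Re (sform B y y))).
Proof.
move=> t01 pr; have c0 := cos_sector_gt0 alpha_ge0 alpha_lt.
have h := sectorial_CS alpha_ge0 alpha_lt x y
  (harm_mean_sectorial alpha_ge0 alpha_lt accA accB sA sB t01)
  (fun z => harm_mean_ge0 z accA accB t01).
have hx := harm_mean_le alpha_ge0 alpha_lt x accA accB sA sB t01 pr.
have hy := harm_mean_le alpha_ge0 alpha_lt y accA accB sA sB t01 pr.
have {}h := le_trans h (lerD hx hy).
rewrite -(ler_pM2l c0) [leLHS]mulrA [cos alpha * 2]mulrC; apply: le_trans h _.
rewrite (exprS _ 2) [leRHS]mulrA [cos alpha * _]mulrA mulfV ?gt_eqF// mul1r -mulrDr.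
by rewrite ler_wpM2l ?exprn_ge0 ?invr_ge0 ?(ltW c0)//; lra.
Qed.

(** An entry is the form at two basis vectors. Rotating the first by a unimodular [a + i b] turns
    [harm_mean_CS] with [p = r = 1] into a bound on [a Re + b Im], uniform in [t]. The directions
    [1], [-1], [i] and [-i] then bound both parts. *)
Lemma harm_mean_entry_bounded i j : exists K, forall t, 0 <= t <= 1 ->
  `|Re (harm_mean t A B i j)| <= K /\ `|Im (harm_mean t A B i j)| <= K.
Proof.
pose e k : 'cV[C]_n := col k 1%:M.
have eE X k l : sform X (e k) (e l) = X k l by rewrite sform_col adjmx1 mul1mx mulmx1.
pose K := (cos alpha)^-1 ^+ 3 * ((Re (A i i) + Re (A j j)) + (Re (B i i) + Re (B j j))).
have c0 := cos_sector_gt0 alpha_ge0 alpha_lt.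
have A0 k : 0 <= Re (A k k) by rewrite -eE accretive_ge0.
have B0 k : 0 <= Re (B k k) by rewrite -eE accretive_ge0.
exists K => t t01.
suff H (a b : R) : a ^+ 2 + b ^+ 2 = 1 ->
    a * Re (harm_mean t A B i j) + b * Im (harm_mean t A B i j) <= K.
  have h1 := H 1 0; have h2 := H (-1) 0; have h3 := H 0 1; have h4 := H 0 (-1).
  rewrite !ler_norml; move: h1 h2 h3 h4; rewrite !expr0n/= !sqrrN !expr1n addr0 add0r.
  by move=> /(_ erefl) ? /(_ erefl) ? /(_ erefl) ? /(_ erefl) ?; split; apply/andP; split; lra.
move=> ab1.
have w1 : (1 - t) * 1 + t * 1 = 1 by ring.
have := harm_mean_CS (Complex a b *: e i) (e j) t01 w1.
have cK (z : C) : Num.conj (Complex a b) * (Complex a b * z) = z.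
  rewrite mulrA; have -> : Num.conj (Complex a b) * Complex a b = 1.
    by apply: complex_ext; rewrite !partsE/= -?ab1; ring.
  by rewrite mul1r.
rewrite !sformZl !sformZr !eE !cK !partsE/= !expr1n !mulr1.
have -> : a * Re (harm_mean t A B i j) - - b * Im (harm_mean t A B i j) =
  a * Re (harm_mean t A B i j) + b * Im (harm_mean t A B i j) by ring.
move=> h; have {}h : 2 * (a * Re (harm_mean t A B i j) + b * Im (harm_mean t A B i j)) <= K.
  apply: le_trans h _; rewrite ler_wpM2l ?exprn_ge0 ?invr_ge0 ?(ltW c0)//.
  have /andP[t0 t1] := t01.
  by rewrite lerD// ler_piMl ?addr_ge0//; lra.
have K0 : 0 <= K by rewrite mulr_ge0 ?exprn_ge0 ?invr_ge0 ?(ltW c0)// !addr_ge0.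
by move: h; move: (a * _ + b * _) => q h; lra.
Qed.

Let mD : measurable D. Proof. exact: measurable_itv. Qed.

Lemma cintegrable_harm_mean i j : cintegrable nu D (fun t => harm_mean t A B i j).
Proof.
have [K HK] := harm_mean_entry_bounded i j.
have mH : cmeasurable D (fun t => harm_mean t A B i j).
  apply: cmeasurable_invmx => [t|k l].
    by rewrite /= in_itv/=; exact: harm_mean_denom_unitmx.
  rewrite (_ : (fun t => _) = (fun t => toC (1 - t) * invmx A k l + toC t * invmx B k l));
    last by apply/funext => t; rewrite !mxE.
  apply: cmeasurableD; apply: cmeasurableM; try exact: cmeasurable_cst.
    by apply: cmeasurable_toC; exact: measurable_funB.
  exact: cmeasurable_toC.
split; apply: (@bounded_integrable _ _ _ nu _ mD _ K) => [|t]; try exact: mH.1; try exact: mH.2.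
- by rewrite /= in_itv/= => /HK[].
- by rewrite /= in_itv/= => /HK[].
Qed.

Lemma sform_mx_mean x y :
  sform (mx_mean nu A B) x y = cintegral nu D (fun t => sform (harm_mean t A B) x y).
Proof. by rewrite -(sform_cintegral mD)//; exact: cintegrable_harm_mean. Qed.

Lemma Re_sform_mx_mean x y : Re (sform (mx_mean nu A B) x y) =
  Rintegral nu D (fun t => Re (sform (harm_mean t A B) x y)).
Proof. by rewrite sform_mx_mean. Qed.

Lemma integrable_sform_harm_mean x y :
  nu.-integrable D (EFin \o (fun t => Re (sform (harm_mean t A B) x y))).
Proof. by have [] := cintegrable_sform mD x y cintegrable_harm_mean. Qed.

Hypothesis nu01 : nu D = 1%E.

Lemma mx_mean_unitmx : mx_mean nu A B \in unitmx.
Proof.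
apply: posRe_unitmx => x x0; rewrite Re_sform_mx_mean.
apply: (Rintegral_gt0 mD) => // [|t]; first exact: integrable_sform_harm_mean.
by rewrite /= in_itv/= => t01; exact: harm_mean_gt0.
Qed.

Variables (a b : R).
Hypothesis a_gt0 : 0 < a.
Hypothesis b_gt0 : 0 < b.
Let p t := scalar_harm_mean t a b / a.
Let r t := scalar_harm_mean t a b / b.
(** [weightA] and [weightB] are the coefficients of [A] and [B] in the matrix [Y] of [mx_mean_CS],
    before the factor [sec^3(alpha)]. *)
Definition weightA := Rintegral nu D (fun t => (1 - t) * p t ^+ 2).
Definition weightB := Rintegral nu D (fun t => t * r t ^+ 2).

Let integrable_weight (w : R -> R) c : 0 < c ->
  measurable_fun D w -> (forall t, 0 <= t <= 1 -> 0 <= w t <= 1) ->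
  nu.-integrable D (EFin \o (fun t => w t * (scalar_harm_mean t a b / c) ^+ 2)).
Proof.
move=> c0 mw w01; apply: (@bounded_integrable _ _ _ nu _ mD _ (((a + b) / c) ^+ 2)).
  apply: measurable_funM => //; apply: measurable_funX.
  apply: measurable_funM; last exact: measurable_cst.
  exact: measurable_scalar_harm_mean.
move=> t; rewrite /= in_itv/= => t01; have /andP[w0 w1] := w01 t t01.
have /andP[h0 h1] := scalar_harm_mean_bounds a_gt0 b_gt0 t01.
rewrite ger0_norm; last by rewrite mulr_ge0 ?sqr_ge0.
apply: le_trans (ler_piMl (sqr_ge0 _) w1) _.
by rewrite ler_sqr ?nnegrE ?divr_ge0 ?addr_ge0 ?(ltW h0) ?(ltW c0) ?(ltW a_gt0) ?(ltW b_gt0)//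
  ler_wpM2r ?invr_ge0 ?(ltW c0).
Qed.

Lemma integrable_weightA : nu.-integrable D (EFin \o (fun t => (1 - t) * p t ^+ 2)).
Proof.
apply: integrable_weight => //; first exact: measurable_funB.
by move=> t /andP[? ?]; apply/andP; split; lra.
Qed.

Lemma integrable_weightB : nu.-integrable D (EFin \o (fun t => t * r t ^+ 2)).
Proof. exact: integrable_weight. Qed.

Lemma weightA_ge0 : 0 <= weightA.
Proof.
apply: Rintegral_ge0 => t; rewrite /= in_itv/= => /andP[_ t1].
by rewrite mulr_ge0 ?sqr_ge0 ?subr_ge0.
Qed.

Lemma weightB_ge0 : 0 <= weightB.
Proof.
apply: Rintegral_ge0 => t; rewrite /= in_itv/= => /andP[t0 _].
by rewrite mulr_ge0 ?sqr_ge0.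
Qed.

(** Pointwise in [t], [(1-t) p^2 a + t r^2 b = h ((1-t) p + t r) = h], where [h] is the scalar
    harmonic mean. Its integral is [a f(b/a)] by the representation of [f]. *)
Lemma weights_scalar_mean f : represents f nu ->
  weightA * a + weightB * b = scalar_mean f a b.
Proof.
move=> [_ fE]; rewrite /scalar_mean fE ?divr_gt0//.
have iA := integrable_weightA; have iB := integrable_weightB.
transitivity (Rintegral nu D (fun t => scalar_harm_mean t a b)).
  rewrite -!RintegralZr// -RintegralD//.
  - apply: eq_Rintegral => t /set_mem; rewrite /= in_itv/= => t01.
    rewrite -[RHS]mulr1 -[in RHS](scalar_harm_mean_weights a_gt0 b_gt0 t01) /p /r.
    by field; rewrite !gt_eqF.
  - exact: integrableEZr.
  - exact: integrableEZr.
have -> : (fun t => scalar_harm_mean t a b) = (fun t => a * ((1 - t) + t / (b / a))^-1).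
  apply/funext => t; rewrite /scalar_harm_mean.
  have -> : (1 - t) / a + t / b = a^-1 * ((1 - t) + t / (b / a)) by field; rewrite !gt_eqF.
  by rewrite invfM invrK.
rewrite RintegralZl//.
(* The kernel representing [f] at [b/a] is [h / a], so it inherits integrability from the bounded
   function [h]. *)
apply: (eq_integrable mD (EFin \o (fun t => a^-1 * scalar_harm_mean t a b))).
  move=> t _ /=; congr (_%:E); rewrite /scalar_harm_mean.
  have -> : (1 - t) / a + t / b = a^-1 * ((1 - t) + t / (b / a)) by field; rewrite !gt_eqF.
  by rewrite invfM invrK mulrA mulVf ?mul1r// gt_eqF.
apply: integrableEZl => //; apply: (@bounded_integrable _ _ _ nu _ mD _ (a + b)).
  exact: measurable_scalar_harm_mean.
move=> t; rewrite /= in_itv/= => t01.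
have /andP[h0 h1] := scalar_harm_mean_bounds a_gt0 b_gt0 t01.
by rewrite gtr0_norm.
Qed.

(** [harm_mean_CS] is used at each [t] with the weights [p t] and [r t], then integrated. The forms
    of [A] and [B] do not depend on [t] and come out of the integral. *)
Lemma mx_mean_CS x y :
  let Y := toC ((cos alpha)^-1 ^+ 3) *: (toC weightA *: A + toC weightB *: B) in
  2 * Re (sform (mx_mean nu A B) x y) <= Re (sform Y x x) + Re (sform Y y y).
Proof.
have iA := integrable_weightA; have iB := integrable_weightB.
rewrite /= !sformZm !sformDm !sformZm !partsE/= ?mul0r ?subr0 ?addr0.
set xA := Re (sform A x x); set yA := Re (sform A y y).
set xB := Re (sform B x x); set yB := Re (sform B y y).
rewrite Re_sform_mx_mean -RintegralZl//; last exact: integrable_sform_harm_mean.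
apply: (@le_trans _ _ (Rintegral nu D (fun t => (cos alpha)^-1 ^+ 3 *
    ((xA + yA) * ((1 - t) * p t ^+ 2) + (xB + yB) * (t * r t ^+ 2))))).
  apply: le_Rintegral => //.
  - by apply: integrableEZl => //; exact: integrable_sform_harm_mean.
  - by apply: integrableEZl => //; apply: integrableED => //; exact: integrableEZl.
  - move=> t; rewrite /= in_itv/= => t01.
    have := harm_mean_CS x y t01 (scalar_harm_mean_weights a_gt0 b_gt0 t01).
    by rewrite ![(xA + yA) * _]mulrC ![(xB + yB) * _]mulrC.
rewrite RintegralZl//; last by apply: integrableED => //; exact: integrableEZl.
rewrite RintegralD//; [|exact: integrableEZl..].
rewrite !RintegralZl// -/weightA -/weightB.
by move: weightA weightB (_ ^-1 ^+ 3) => ? ? ?; lra.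
Qed.

End MatrixMean.

Theorem mainTheorem18 (R : realType) (n : nat) (A B : 'M[R[i]]_n) (alpha : R) :
  0 <= alpha -> alpha < pi / 2 ->
  accretive A -> accretive B ->
  numerical_range A `<=` sector alpha -> numerical_range B `<=` sector alpha ->
  forall (N : 'M[R[i]]_n -> R), unitarily_invariant_norm N ->
  forall (f : R -> R) (nu : probability R R), in_frak_m f -> represents f nu ->
  N (mx_mean nu A B) <= (cos alpha)^-1 ^+ 3 * scalar_mean f (N A) (N B).
Proof.
move=> alpha_ge0 alpha_lt accA accB WA WB N hN f nu _ rep.
have c0 := cos_sector_gt0 alpha_ge0 alpha_lt.
(* In dimension zero every norm vanishes, so [N A] and [N B] are not positive, but both sides of the
   claim are 0. *)
have [n0|n_gt0] := posnP n.
  have N0 X : N X = 0.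
    have -> : X = toC 0 *: X.
      by apply/matrixP => i; have := ltn_ord i; rewrite [X in (_ < X)%N]n0.
    by rewrite uinormZ// mul0r.
  by rewrite !N0 /scalar_mean mul0r mulr0.
(* An accretive matrix is invertible, hence nonzero in positive dimension. This makes the scalar
   mean of [N A] and [N B] one of positive numbers. *)
have N_gt0 X : accretive X -> 0 < N X.
  move=> accX; rewrite lt0r uinorm_ge0// andbT; apply/eqP => NX0.
  have X0 : X = 0 by case: hN => _ + _ _ _; apply.
  by have /mxrank_unit := accretive_unitmx accX; rewrite X0 mxrank0 => n0; rewrite -n0 in n_gt0.
have sA := numerical_range_sectorial alpha_ge0 alpha_lt WA.
have sB := numerical_range_sectorial alpha_ge0 alpha_lt WB.
have a0 := N_gt0 A accA; have b0 := N_gt0 B accB.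
have nu01 := rep.1.
(* With [a = N A] and [b = N B], the scalar mean becomes [weightA * N A + weightB * N B], which is
   what the triangle inequality gives for [Y]. *)
rewrite -(weights_scalar_mean a0 b0 rep).
apply: le_trans (uinorm_le_form hN (mx_mean_unitmx alpha_ge0 alpha_lt accA accB sA sB nu01)
  (mx_mean_CS nu alpha_ge0 alpha_lt accA accB sA sB a0 b0)) _.
rewrite uinormZ ?exprn_ge0 ?invr_ge0 ?(ltW c0)//.
rewrite ler_wpM2l ?exprn_ge0 ?invr_ge0 ?(ltW c0)//.
apply: le_trans (uinormD hN _ _) _.
by rewrite !uinormZ ?weightA_ge0 ?weightB_ge0.
Qed.
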